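(* Let $1\le p<\infty$, let $(X,d)$ be a separable metric space, and let $\mu\in\mathcal{P}_{p-1}(X)$. Let $(\Omega,\mathcal{F},\mathbb{P})$ be a complete probability space on which i.i.d. $X$-valued random elements $Y_1,Y_2,\ldots$ with common distribution $\mu$ are defined, and let $\bar\mu_n=\frac1n\sum_{i=1}^n\delta_{Y_i}$. Then for any random elements $\{(C_n,\eta_n)\}_{n\in\mathbb{N}}$ and $(C,\eta)$ of $\mathrm{C}(X)\times[0,\infty)$ defined on $\Omega$, we have $$\underset{n\to\infty}{\mathrm{Ls}}\,F_p(\bar\mu_n,C_n,\eta_n)\subseteq F_p(\mu,C,\eta)$$ almost surely on $\{\mathrm{Lt}_{n\to\infty}C_n=C \text{ and } \eta_n\to\eta\}$.
   Context: Convention: $0^0=1$. For $r\ge 0$, $\mathcal{P}_r(X)$ is the set of Borel probability measures $\mu$ on $X$ with $\int_X d^r(x,y)\,d\mu(y)<\infty$ for all $x\in X$. For $\mu\in\mathcal{P}_{p-1}(X)$ and $x,z\in X$ set $f_p(\mu,x,z)=\int_X (d^p(x,y)-d^p(z,y))\,d\mu(y)$ (the integrand is $\mu$-integrable). For $C\subseteq X$ closed and $\eta\ge0$, the $\eta$-relaxed $C$-restricted Fréchet $p$-mean is $$F_p(\mu,C,\eta)=\{x\in C: f_p(\mu,x,z)\le\eta\ \text{for all } z\in C\},$$ which is a (possibly empty) closed set. $\mathrm{C}(X)$ is the collection of closed subsets of $X$, equipped with the Effros $\sigma$-algebra, generated by the sets $\{C\in \mathrm{C}(X): C\cap U\neq\emptyset\}$,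 $U\subseteq X$ open. For a sequence $\{C_n\}$ in $\mathrm{C}(X)$, $\mathrm{Ls}_{n\to\infty}C_n=\bigcap_{n\ge1}\overline{\bigcup_{m\ge n}C_m}$ is the set of $x$ such that every open neighborhood of $x$ meets $C_n$ for infinitely many $n$, and $\mathrm{Li}_{n\to\infty}C_n$ is the set of $x$ such that every open neighborhood of $x$ meets $C_n$ for all sufficiently large $n$. We write $\mathrm{Lt}_{n\to\infty}C_n=C$ if $\mathrm{Ls}_{n\to\infty}C_n=\mathrm{Li}_{n\to\infty}C_n=C$. ''Almost surely on $E$'' means that there is a $\mathbb{P}$-null set $N$ such that the conclusion holds for all $\omega\in E\setminus N$. *)

(* Defs.v *)
From HB Require Import structures.
From mathcomp Require Import all_boot all_order all_algebra.
From mathcomp Require Import finmap.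
From mathcomp Require Import all_classical all_reals all_analysis.
Import Order.TTheory GRing.Theory Num.Theory.
Import numFieldNormedType.Exports.

Set Implicit Arguments.
Unset Strict Implicit.
Unset Printing Implicit Defensive.

Local Open Scope classical_set_scope.
Local Open Scope ring_scope.

(* A measurableType is pointed, so a metric space that carries Borel measures
   has to be pointed as well; this only excludes the empty space, on which
   there is no probability measure. *)
#[short(type="pmetricType")]
HB.structure Definition PMetric (R : numDomainType) :=
  {T of Metric R T & isPointed T}.

Definition separable (T : topologicalType) : Prop :=
  exists2 D : set T, countable D & dense D.

Definition borel (R : numDomainType) (X : pmetricType R) :=
  g_sigma_algebraType (@open X).

Record closed_sets (T : topologicalType) : Type := ClosedSet {
  closed_carrier :> set T ;
  closed_carrierP : closed closed_carrier }.

HB.instance Definition _ (T : topologicalType) := gen_eqMixin (closed_sets T).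
HB.instance Definition _ (T : topologicalType) :=
  gen_choiceMixin (closed_sets T).
HB.instance Definition _ (T : topologicalType) :=
  isPointed.Build (closed_sets T) (ClosedSet (@closed0 T)).

Definition hits (T : topologicalType) (U : set T) : set (closed_sets T) :=
  [set C | C `&` U !=set0].

Definition effros_generators (T : topologicalType) : set (set (closed_sets T)) :=
  [set hits U | U in @open T].

HB.instance Definition _ (T : topologicalType) :=
  Measurable.copy (closed_sets T) (g_sigma_algebraType (@effros_generators T)).

Section kuratowski_limits.
Context (T : topologicalType).
Implicit Types (C : nat -> set T) (L : set T).

Definition Ls C : set T := \bigcap_n closure (\bigcup_(m >= n) C m).

Definition Li C : set T :=
  [set x | forall U, open_nbhs x U -> \forall n \near \oo, C n `&` U !=set0].

Definition Lt C L : Prop := Ls C = L /\ Li C = L.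

End kuratowski_limits.

(* The convention 0^0 = 1 is built into powR, see powRr0. *)
Section frechet_means.
Context (R : realType) (X : pmetricType R).
Implicit Types (mu : probability (borel X) R) (r p eta : R).

Definition finite_moment r mu : Prop :=
  forall x : X, (\int[mu]_y ((mdist x (y : X)) `^ r)%:E < +oo)%E.

Definition frechet_fun p mu (x z : X) : \bar R :=
  (\int[mu]_y ((mdist x (y : X)) `^ p - (mdist z (y : X)) `^ p)%R%:E)%E.

Definition frechet_mean p mu (C : set X) eta : set X :=
  [set x | C x /\ forall z, C z -> (frechet_fun p mu x z <= eta%:E)%E].

End frechet_means.

Section empirical_measure.
Context d (T : measurableType d) (R : realType).
Variables (y : nat -> T) (n : nat).

(* n.+1 sample points y 0, ..., y n, so that no empty sample occurs. *)
Definition empirical : set T -> \bar R :=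
  mscale (n.+1%:R^-1 : R)%:nng (msum (fun i => \d_(y i)) n.+1).

HB.instance Definition _ := Measure.on empirical.

Let empirical_setT : empirical [set: T] = 1%E.
Proof.
rewrite /empirical /mscale/= /msum (eq_bigr (fun=> 1%:E)) => [|i _].
  by rewrite sumEFin sumr_const card_ord -EFinM mulVf// pnatr_eq0.
by rewrite [LHS]diracT.
Qed.

HB.instance Definition _ :=
  Measure_isProbability.Build _ _ _ empirical empirical_setT.

End empirical_measure.

Section iid.
Context d (Omega : measurableType d) d' (T : measurableType d') (R : realType).
Variable P : probability Omega R.

Definition mutually_independent (Y : nat -> {RV P >-> T}) : Prop :=
  forall (J : {fset nat}) (A : nat -> set T), (forall i, measurable (A i)) ->
    P (\bigcap_(i in [set` J]) (Y i @^-1` A i))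
    = (\prod_(i <- J) P (Y i @^-1` A i))%E.

(* Set functions are compared on measurable sets only: a measure is an
   arbitrary function outside of them. *)
Definition iid (mu : probability T R) (Y : nat -> {RV P >-> T}) : Prop :=
  mutually_independent Y /\
  forall i A, measurable A -> distribution P (Y i) A = mu A.

End iid.

(* Main.v *)
(* After the strong law of large numbers for integrable functions of an i.i.d.
   sequence, the argument is deterministic. If x_n in F_p(mu_n, C_n, eta_n) tends
   to x along a subsequence and z_n in C_n tends to z in C, then the empirical
   integrals of d^p(x_n, .) - d^p(z_n, .) are at most eta_n. By the inequality
   |a^p - b^p| <= p |a - b| (a^(p-1) + b^(p-1)), replacing x_n, z_n, x, z by points
   of a countable dense set costs at most a small multiple of the mean of
   1 + d^(p-1)(o, .), so it suffices that the law of large numbers holds for the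
   countably many dense pairs and for d^(p-1)(o, .).

   The law of large numbers follows from pairwise independence: for bounded
   functions by Chebyshev's inequality along the squares; for the tails
   g - g 1{|g| <= q} by an almost sure bound of their means by twice their integral,
   obtained by truncation and Chebyshev's inequality along the powers of 2. *)
Require Import Defs.
From HB Require Import structures.
From mathcomp Require Import all_boot all_order all_algebra.
From mathcomp Require Import finmap.
From mathcomp Require Import all_classical all_reals all_analysis.
From mathcomp Require Import measurable_realfun.
From mathcomp Require Import zify ring lra.
Import Order.TTheory GRing.Theory Num.Theory.
Import numFieldNormedType.Exports.

Set Implicit Arguments.
Unset Strict Implicit.
Unset Printing Implicit Defensive.

Local Open Scope classical_set_scope.
Local Open Scope ring_scope.

(** * Integrability of bounded functions and of finite sums *)

Lemma bounded_integrable {d} {T : measurableType d} {R : realType}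
    (P : probability T R) (f : T -> R) (M : R) :
  measurable_fun [set: T] f -> (forall x, `|f x| <= M) ->
  P.-integrable [set: T] (EFin \o f).
Proof.
move=> mf fM; apply: measurable_bounded_integrable => //.
  by rewrite (le_lt_trans (probability_le1 P measurableT))// ltry.
exists M; split; first exact: num_real.
by move=> x Mx y _ /=; rewrite (le_trans (fM y))// ltW.
Qed.

Lemma integrable_sum_EFin {d} {T : measurableType d} {R : realType}
    (mu : {measure set T -> \bar R}) (I : Type) (s : seq I) (F : I -> T -> R) :
  (forall i, mu.-integrable [set: T] (EFin \o F i)) ->
  mu.-integrable [set: T] (EFin \o (fun x => \sum_(i <- s) F i x)).
Proof.
move=> iF; rewrite (_ : _ \o _ = fun x => (\sum_(i <- s) (F i x)%:E)%E).
  by apply: integrable_sum => // i _; exact: iF.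
by apply/funext => x /=; rewrite sumEFin.
Qed.

Lemma Rintegral_sum {d} {T : measurableType d} {R : realType}
    (mu : {measure set T -> \bar R}) (I : Type) (s : seq I) (F : I -> T -> R) :
  (forall i, mu.-integrable [set: T] (EFin \o F i)) ->
  \int[mu]_x (\sum_(i <- s) F i x) = \sum_(i <- s) \int[mu]_x F i x.
Proof.
move=> iF; elim: s => [|i s ih].
  rewrite big_nil (_ : (fun x => _) = cst 0).
    by rewrite /Rintegral integral0.
  by apply/funext => x; rewrite big_nil.
rewrite big_cons -ih -RintegralD//; last exact: integrable_sum_EFin.
by apply: eq_Rintegral => x _; rewrite big_cons.
Qed.

(** * Change of variables, independence and second moments for i.i.d. samples *)

Section iid_samples.
Context {d} {Omega : measurableType d} {d'} {T : measurableType d'}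
  {R : realType} {P : probability Omega R} {mu : probability T R}
  {Y : nat -> {RV P >-> T}} (iidY : iid mu Y).

Lemma iid_preimage i A : measurable A -> P (Y i @^-1` A) = mu A.
Proof. by move=> mA; rewrite -(iidY.2 i). Qed.

Lemma iid_ge0_integral i (f : T -> \bar R) :
  measurable_fun [set: T] f -> (forall x, 0 <= f x)%E ->
  (\int[P]_w f (Y i w) = \int[mu]_x f x)%E.
Proof.
move=> mf f0.
rewrite -(@eq_measure_integral _ _ _ _ mu (distribution P (Y i))).
  by rewrite ge0_integral_distribution.
by move=> A mA _; exact: iidY.2.
Qed.

Lemma iid_Rintegral i (f : T -> R) :
  measurable_fun [set: T] f -> mu.-integrable [set: T] (EFin \o f) ->
  \int[P]_w f (Y i w) = \int[mu]_x f x.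
Proof.
move=> mf fi; congr fine.
rewrite -(@eq_measure_integral _ _ _ _ mu (distribution P (Y i))); last first.
  by move=> A mA _; exact: iidY.2.
rewrite integral_distribution//; first exact/measurable_EFinP.
apply/integrableP; split.
  by apply/measurable_EFinP; exact: measurableT_comp.
(* The nonnegative change of variables, applied to [|f|], transports integrability from [mu] to
   [P]. *)
have /integrableP[_] := fi.
rewrite -(@iid_ge0_integral i (fun x => `|(f x)%:E|%E))//.
by apply: measurableT_comp => //; exact/measurable_EFinP.
Qed.

Lemma iid_preimage2 i j A B : i != j -> measurable A -> measurable B ->
  (P (Y i @^-1` A `&` Y j @^-1` B) = mu A * mu B)%E.
Proof.
(* Independence takes a set for every index; on the index set [{i, j}] only the values [A] at [i]
   and [B] at [j] are seen. *)
move=> ij mA mB; pose F k := if k == i then A else B.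
have mF k : measurable (F k) by rewrite /F; case: ifP.
have := iidY.1 [fset i; j]%fset F mF.
rewrite big_fsetU1/= ?inE// big_seq_fset1 !iid_preimage// /F eqxx.
rewrite eq_sym (negbTE ij) => <-; congr (P _).
apply/seteqP; split => [w [Aw Bw] k /=|w H].
  by rewrite !inE => /orP[]/eqP -> /=; rewrite ?eqxx// eq_sym (negbTE ij).
split.
  by have := H i; rewrite /= !inE eqxx => /(_ isT).
by have := H j; rewrite /= !inE eqxx orbT eq_sym (negbTE ij) => /(_ isT).
Qed.

(** By pairwise independence the joint law of [(Y i, Y j)] agrees with the product measure on
    rectangles, hence on all measurable sets. Fubini then separates the two factors. *)
Lemma iid_Rintegral2 i j (f g : T -> R) (M : R) : i != j ->
  measurable_fun [set: T] f -> (forall x, `|f x| <= M) ->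
  measurable_fun [set: T] g -> (forall x, `|g x| <= M) ->
  \int[P]_w (f (Y i w) * g (Y j w)) = (\int[mu]_x f x) * (\int[mu]_x g x).
Proof.
move=> ij mf fM mg gM.
pose h (z : T * T) := (f z.1 * g z.2)%:E : \bar R.
have mh : measurable_fun [set: T * T] h.
  apply/measurable_EFinP; apply: measurable_funM.
    exact: measurableT_comp.
  exact: measurableT_comp.
have mYY : measurable_fun [set: Omega] (fun w => (Y i w, Y j w)).
  exact: measurable_fun_pair.
pose YY : {RV P >-> (T * T)%type} := HB.pack (fun w => (Y i w, Y j w))
  (isMeasurableFun.Build _ _ _ _ _ mYY).
have prodE A : measurable A -> (mu \x mu)%E A = distribution P YY A.
  apply: product_measure_unique => A1 A2 mA1 mA2.
  by rewrite -(iid_preimage2 ij mA1 mA2).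
have hM z : (`|h z| <= (M * M)%:E)%E.
  by rewrite lee_fin normrM ler_pM.
have ih : (mu \x mu)%E.-integrable [set: T * T] h.
  apply/integrableP; split => //.
  rewrite (@eq_measure_integral _ _ _ _ (distribution P YY)); last first.
    by move=> A mA _; exact: prodE.
  have /integrableP[] // : (distribution P YY).-integrable [set: T * T] h.
  apply: (@bounded_integrable _ _ _ _ (fun z => f z.1 * g z.2) (M * M)) => //.
  exact/measurable_EFinP.
have fi := bounded_integrable mu mf fM.
have gi := bounded_integrable mu mg gM.
rewrite /Rintegral.
transitivity (fine (\int[mu]_x \int[mu]_y h (x, y))).
  congr fine; rewrite integral12_prod_meas1//.
  rewrite (@eq_measure_integral _ _ _ _ (distribution P YY)); last first.
    by move=> A mA _; exact: prodE.
  rewrite integral_distribution//.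
  apply: (@bounded_integrable _ _ _ _ (fun w => f (Y i w) * g (Y j w)) (M * M)).
    by apply: measurable_funM; exact: measurableT_comp.
  by move=> w; exact: (hM (Y i w, Y j w)).
have -> : (fun x => \int[mu]_y h (x, y))%E =
    (fun x => (f x)%:E * \int[mu]_y (g y)%:E)%E.
  apply/funext => x; rewrite -integralZl//.
rewrite -[in LHS](fineK (integrable_fin_num measurableT gi)).
by rewrite integralZr// fineM//; exact: integrable_fin_num.
Qed.

(** After expanding the square, the off-diagonal terms vanish because the summands are centred and
    pairwise independent. Each diagonal term is the variance of [f], at most its second moment. *)
Lemma iid_second_moment n (f : T -> R) (M : R) :
  measurable_fun [set: T] f -> (forall x, `|f x| <= M) ->
  \int[P]_w (\sum_(i < n) (f (Y i w) - \int[mu]_x f x)) ^+ 2 <=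
  n%:R * \int[mu]_x (f x) ^+ 2.
Proof.
move=> mf fM; set c := \int[mu]_x f x; pose u x := f x - c.
have mu_ : measurable_fun [set: T] u by exact: measurable_funB.
have uM x : `|u x| <= M + `|c| by rewrite (le_trans (ler_normB _ _))// lerD2r.
have fi := bounded_integrable mu mf fM.
have ci : mu.-integrable [set: T] (EFin \o cst c).
  exact: (bounded_integrable mu (M := `|c|)).
have fi2 : mu.-integrable [set: T] (EFin \o (fun x => f x ^+ 2)).
  apply: (bounded_integrable mu (M := M ^+ 2)).
    exact: measurable_funX.
  by move=> x; rewrite normrX ler_pXn2r// ?nnegrE// (le_trans _ (fM x)).
have cst1 : \int[mu]_x (cst c) x = c.
  by rewrite Rintegral_cst//= probability_setT mulr1.
have u0 : \int[mu]_x u x = 0.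
  by rewrite RintegralB// cst1 subrr.
have u2 : \int[mu]_x (u x * u x) <= \int[mu]_x (f x) ^+ 2.
  have -> : \int[mu]_x (u x * u x) =
      \int[mu]_x (f x ^+ 2) - c ^+ 2.
    rewrite (_ : (fun x => u x * u x) =
      (fun x => f x ^+ 2 - ((2 * c) * f x - c ^+ 2))); last first.
      by apply/funext => x; rewrite /u; ring.
    have c2i : mu.-integrable [set: T] (EFin \o cst (c ^+ 2)).
      exact: (bounded_integrable mu (M := `|c ^+ 2|)).
    have cfi : mu.-integrable [set: T] (EFin \o (fun x => 2 * c * f x)).
      rewrite (_ : _ \o _ = fun x => ((2 * c)%:E * (f x)%:E)%E)//.
      exact: integrableZl.
    rewrite RintegralB//; last exact: (integrableB measurableT cfi c2i).
    rewrite RintegralB// RintegralZl// -/c Rintegral_cst//= probability_setT mulr1.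
    ring.
  by rewrite gerBl sqr_ge0.
have uui i j : P.-integrable [set: Omega] (EFin \o (fun w => u (Y i w) * u (Y j w))).
  apply: (bounded_integrable P (M := (M + `|c|) * (M + `|c|))).
    by apply: measurable_funM; exact: measurableT_comp.
  by move=> w; rewrite normrM ler_pM.
rewrite (_ : (fun w => _ ^+ 2) =
    fun w => \sum_(i < n) \sum_(j < n) (u (Y i w) * u (Y j w))); last first.
  by apply/funext => w; rewrite expr2 mulr_suml; apply: eq_bigr => i _;
    rewrite mulr_sumr.
rewrite Rintegral_sum; last first.
  by move=> i; apply: integrable_sum_EFin => j.
rewrite [leLHS](_ : _ = \sum_(i < n) \int[mu]_x (u x * u x)).
  by rewrite sumr_const card_ord -[leLHS]mulr_natl; exact: ler_wpM2l.
apply: eq_bigr => i _; rewrite Rintegral_sum//.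
rewrite (bigD1 i)//= big1 ?addr0; last first.
  by move=> j ji; rewrite (iid_Rintegral2 _ mu_ uM mu_ uM) 1?eq_sym// u0 mul0r.
apply: (@iid_Rintegral _ (fun x => u x * u x)); first exact: measurable_funM.
apply: (bounded_integrable mu (M := (M + `|c|) * (M + `|c|))).
  exact: measurable_funM.
by move=> w; rewrite normrM ler_pM.
Qed.

End iid_samples.

(** * Domination, Markov's inequality, Borel-Cantelli and Chebyshev's inequality *)

Lemma integrable_normr_le {d} {T : measurableType d} {R : realType}
    (mu : {measure set T -> \bar R}) (f g : T -> R) :
  measurable_fun [set: T] f -> (forall x, `|f x| <= g x) ->
  mu.-integrable [set: T] (EFin \o g) -> mu.-integrable [set: T] (EFin \o f).
Proof.
move=> mf fg; apply: le_integrable => //; first exact/measurable_EFinP.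
by move=> x _ /=; rewrite lee_fin (le_trans (fg x))// ler_norm.
Qed.

(** [Z] dominates [a] times the indicator of the event; integrate. *)
Lemma markov_Rintegral {d} {T : measurableType d} {R : realType}
    (P : probability T R) (Z : T -> R) (a : R) : 0 < a ->
  measurable_fun [set: T] Z -> (forall x, 0 <= Z x) ->
  P.-integrable [set: T] (EFin \o Z) ->
  (P [set x | (a <= Z x)%R] <= (a^-1 * \int[P]_x Z x)%:E)%E.
Proof.
move=> a0 mZ Z0 iZ.
have mE : measurable [set x | a <= Z x].
  rewrite -[X in measurable X]setTI.
  exact: (measurable_fun_le measurableT (measurable_cst a) mZ).
rewrite -[leLHS]fineK; last exact: fin_num_measure.
rewrite lee_fin ler_pdivlMl//.
have -> : a * fine (P [set x | a <= Z x]) =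
    \int[P]_x (a * \1_[set x | a <= Z x] x).
  rewrite RintegralZl//; last first.
    apply: (bounded_integrable P (M := 1)).
      exact: measurable_indic.
    by move=> x; rewrite indicE normr_nat; case: (_ \in _).
  by rewrite /Rintegral integral_indic// setIT.
apply: le_Rintegral => //.
  apply: (bounded_integrable P (M := a)).
    by apply: measurable_funM => //; exact: measurable_indic.
  move=> x; rewrite indicE normrM gtr0_norm// normr_nat.
  by case: (_ \in _); rewrite ?mulr1// mulr0 ltW.
move=> x _; rewrite indicE; case: (boolP (x \in _)) => [/set_mem/= ax|_].
  by rewrite mulr1.
by rewrite mulr0.
Qed.

(** Bounded partial sums make the series of measures converge, so the limsup of the [F k] is a null
    set; it contains every point that lies in infinitely many [F k]. *)
Lemma borel_cantelli_ae {d} {T : measurableType d} {R : realType}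
    (P : {measure set T -> \bar R}) (F : nat -> set T) (B : R) :
  (forall k, measurable (F k)) ->
  (forall K, \sum_(k < K) P (F k) <= B%:E)%E ->
  {ae P, forall w, \forall k \near \oo, ~ F k w}.
Proof.
move=> mF FB; exists (lim_sup_set F); split.
- apply: bigcap_measurable => // n _.
  by apply: bigcup_measurable => k _.
- apply: lim_sup_set_cvg0 => //.
  apply: (@le_lt_trans _ _ B%:E); last by rewrite ltry.
  apply: lime_le; first exact: is_cvg_nneseries.
  by apply: nearW => K; rewrite big_mkord.
- move=> w /= NF n _; apply: contrapT => H; apply: NF.
  exists n => // k /= nk Fk; apply: H; exists k => //.
Qed.

Section iid_chebyshev.
Context {d} {Omega : measurableType d} {d'} {T : measurableType d'}
  {R : realType} {P : probability Omega R} {mu : probability T R}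
  {Y : nat -> {RV P >-> T}} (iidY : iid mu Y).

Lemma iid_chebyshev n (f : T -> R) (M a : R) :
  measurable_fun [set: T] f -> (forall x, `|f x| <= M) -> 0 < a ->
  (P [set w | (a <= `|\sum_(i < n) (f (Y i w) - \int[mu]_x f x)|)%R] <=
   ((a ^+ 2)^-1 * (n%:R * \int[mu]_x (f x) ^+ 2))%:E)%E.
Proof.
move=> mf fM a0; set c := \int[mu]_x f x.
set S := fun w => \sum_(i < n) (f (Y i w) - c).
have mS : measurable_fun [set: Omega] S.
  by apply: measurable_sum => i; apply: measurable_funB => //;
    exact: measurableT_comp.
have SM w : `|S w| <= n%:R * (M + `|c|).
  rewrite (le_trans (ler_norm_sum _ _ _))// -[n in n%:R]card_ord mulr_natl.
  rewrite -sumr_const ler_sum// => i _.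
  by rewrite (le_trans (ler_normB _ _))// lerD2r.
(* Squaring turns the event into one about [S ^+ 2], whose integral [iid_second_moment] bounds. *)
rewrite (_ : [set w | _] = [set w | a ^+ 2 <= S w ^+ 2]); last first.
  apply/seteqP; split => w /=; rewrite -[S w ^+ 2]real_normK ?num_real//;
    by rewrite ler_pXn2r// nnegrE ltW.
apply: (le_trans (markov_Rintegral _ _ _ _)).
- by rewrite exprn_gt0.
- exact: measurable_funX.
- by move=> w; exact: sqr_ge0.
- apply: (bounded_integrable P (M := (n%:R * (M + `|c|)) ^+ 2)).
    exact: measurable_funX.
  by move=> w; rewrite normrX ler_pXn2r// nnegrE// (le_trans _ (SM w)).
- rewrite lee_fin ler_wpM2l ?invr_ge0 ?sqr_ge0//.
  exact: (iid_second_moment iidY n mf fM).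
Qed.

End iid_chebyshev.

(** * Sample means, elementary sums, truncation, and the passage from squares to all sample sizes *)

Definition sample_mean {T : Type} {R : realType} (y : nat -> T) (n : nat)
    (g : T -> R) : R :=
  n.+1%:R^-1 * \sum_(i < n.+1) g (y i).

(** The induction proves the sharper bound [2 - K.+1%:R^-1], which telescopes since
    [1/(x+1)^2 <= 1/x - 1/(x+1)]. *)
Lemma sum_inv_squares_le2 {R : realType} (K : nat) :
  \sum_(k < K) (k.+1%:R ^+ 2)^-1 <= 2 :> R.
Proof.
case: K => [|K]; first by rewrite big_ord0.
suff : \sum_(k < K.+1) (k.+1%:R ^+ 2)^-1 <= 2 - K.+1%:R^-1 :> R.
  by move=> /le_trans; apply; rewrite gerBl invr_ge0 ler0n.
elim: K => [|K ih]; first by rewrite big_ord1 !mulr1n expr1n !invr1; lra.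
rewrite big_ord_recr/=.
suff : (K.+2%:R ^+ 2)^-1 <= K.+1%:R^-1 - K.+2%:R^-1 :> R.
  by move=> /(lerD ih)/le_trans; apply; rewrite addrA subrK.
have aux (x : R) : 0 < x -> ((x + 1) ^+ 2)^-1 <= x^-1 - (x + 1)^-1.
  move=> x0; have -> : x^-1 - (x + 1)^-1 = (x * (x + 1))^-1.
    by field; apply/andP; split; lra.
  have x1 : 0 < x + 1 by lra.
  by rewrite lef_pV2 ?posrE ?mulr_gt0 ?exprn_gt0// expr2 ler_pM2r// lerDl.
by rewrite -natr1; apply: aux; rewrite ltr0n.
Qed.

Lemma square_sandwich (n : nat) : exists k, (k ^ 2 <= n < k.+1 ^ 2)%N.
Proof.
elim: n => [|n [k /andP[kn nk]]]; first by exists 0%N.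
have [nk'|nk'] := ltnP n.+1 (k.+1 ^ 2).
  by exists k; rewrite nk' andbT (leq_trans kn).
by exists k.+1; rewrite nk'/= (leq_ltn_trans nk)// ltn_exp2r.
Qed.

(* The sum of the [2 ^ k] with [2 ^ k < t] is at most twice its last term. *)
Lemma sum_dyadic_below {R : realType} (t : R) (K : nat) : 0 <= t ->
  \sum_(k < K) (if 2 ^+ k < t then 2 ^+ k else 0) <= 2 * t.
Proof.
move=> t0; elim: K => [|K ih]; first by rewrite big_ord0 mulr_ge0.
rewrite big_ord_recr/=; case: ifPn => [Kt|_]; last by rewrite addr0.
have : \sum_(k < K) (if 2 ^+ k < t then 2 ^+ k else 0) <= 2 ^+ K :> R.
  elim: K {ih Kt} => [|K ih]; first by rewrite big_ord0 ler01.
  rewrite big_ord_recr/= exprS mulr_natl mulr2n lerD//.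
  by case: ifP => // _; exact: exprn_ge0.
by move=> ?; lra.
Qed.

(** The terms vanish until [2 ^+ k] reaches [t], and from then on form a geometric series of ratio
    1/2. The induction carries along the remaining tail [2 * t ^+ 2 / 2 ^+ K], which is at most
    [2 * t] when the series starts. *)
Lemma sum_dyadic_above {R : realType} (t : R) (K : nat) : 0 <= t ->
  \sum_(k < K) (2 ^+ k)^-1 * (if t <= 2 ^+ k then t else 0) ^+ 2 <= 2 * t.
Proof.
move=> t0; pose U K := \sum_(k < K) (2 ^+ k)^-1 * (if t <= 2 ^+ k then t else 0) ^+ 2.
suff : (if t <= 2 ^+ K then U K + 2 * t ^+ 2 / 2 ^+ K <= 2 * t else U K == 0).
  case: ifP => _; last by rewrite -/(U K) => /eqP ->; rewrite mulr_ge0.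
  apply: le_trans; rewrite lerDl divr_ge0// ?exprn_ge0// mulr_ge0// sqr_ge0//.
elim: K => [|K].
  rewrite /U big_ord0 expr0 divr1; case: ifP => // t1.
  by rewrite add0r expr2 mulrA ler_piMr// mulr_ge0.
rewrite /U big_ord_recr/= -/(U K).
have p0 : 0 < 2 ^+ K :> R by exact: exprn_gt0.
have [tK|tK] := leP t (2 ^+ K) => ih.
  have -> : t <= 2 ^+ K.+1.
    by rewrite (le_trans tK)// exprS ler_peMl ?ler1n// ltW.
  rewrite (le_trans _ ih)// -addrA lerD2l [2 ^+ K.+1]exprS.
  rewrite le_eqVlt; apply/orP; left; apply/eqP; field.
  by rewrite gt_eqF.
rewrite (eqP ih) expr0n/= mulr0 addr0; case: ifP => // tK1; rewrite add0r.
have : t / 2 ^+ K.+1 <= 1 by rewrite ler_pdivrMr ?mul1r// exprn_gt0.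
by move=> H; rewrite expr2 -!mulrA ler_pM2l// ler_piMr.
Qed.

Definition truncate {T : Type} {R : realType} (c : R) (g : T -> R) (x : T) : R :=
  if `|g x| <= c then g x else 0.

Lemma measurable_truncate {d} {T : measurableType d} {R : realType} (c : R)
    (g : T -> R) :
  measurable_fun [set: T] g -> measurable_fun [set: T] (truncate c g).
Proof.
move=> mg; apply: measurable_fun_ifT => //.
by apply: measurable_fun_ler => //; exact: measurableT_comp.
Qed.

Lemma normr_truncate {T : Type} {R : realType} (c : R) (g : T -> R) x :
  0 <= c -> `|truncate c g x| <= c.
Proof. by rewrite /truncate; case: ifP => // _; rewrite normr0. Qed.

(** Between consecutive squares [k.+1 ^ 2] and [k.+2 ^ 2] there are at most [3 * k.+1] additional
    terms, each bounded by [M], which is negligible against [k.+1 ^ 2]. *)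
Lemma mean_small_from_squares {R : realType} (v : nat -> R) (M : R) :
  (forall i, `|v i| <= M) ->
  (forall q : nat, \forall k \near \oo,
    `|\sum_(i < k.+1 ^ 2) v i| < (k.+1 ^ 2)%:R / q.+1%:R) ->
  forall e : R, 0 < e -> \forall n \near \oo,
    `|\sum_(i < n.+1) v i| <= e * n.+1%:R.
Proof.
move=> vM small e e0.
have M0 : 0 <= M by rewrite (le_trans _ (vM 0%N)).
have [q _ /(_ _ (leqnn _)) qe] : \forall q \near \oo, q.+1%:R^-1 < e / 2.
  by apply: near_infty_natSinv_lt (PosNum (divr_gt0 e0 (ltr0Sn _ 1))).
have [K1 _ HK1] := small q.
(* For [k] beyond this threshold the incomplete block, at most [3 * k.+1 * M], is below [e / 2]
   times [k.+1 ^ 2]; the choice of [q] gives the other half of [e]. *)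
pose K2 := Num.bound (6 * M / e).
have HK2 : 6 * M / e < K2%:R by rewrite archi_boundP// divr_ge0 ?mulr_ge0// ltW.
pose K := maxn K1 K2.
exists ((K.+2) ^ 2)%N => // n /= Kn.
have [[|k] /andP[kn nk]] := square_sandwich n.+1.
  by move: nk; rewrite exp1n ltnS ltn0.
have Kk : (K <= k)%N.
  rewrite leqNgt; apply/negP => kK.
  have := leq_ltn_trans Kn (ltn_trans (ltnSn n) nk).
  by rewrite ltn_exp2r// !ltnS leqNgt => /negP; apply; rewrite ltnW.
have splitE : \sum_(i < n.+1) v i =
    \sum_(i < k.+1 ^ 2) v i + \sum_(k.+1 ^ 2 <= i < n.+1) v i.
  by rewrite -!(big_mkord xpredT) -big_cat_nat.
rewrite splitE (le_trans (ler_normD _ _))//.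
have tail : `|\sum_(k.+1 ^ 2 <= i < n.+1) v i| <= 3 * k.+1%:R * M.
  rewrite (le_trans (ler_norm_sum _ _ _))//.
  rewrite (le_trans (ler_sum _ (fun i _ => vM i)))//.
  rewrite big_const_nat iter_addr_0 -[M *+ _]mulr_natl ler_wpM2r//.
  rewrite -natrM ler_nat leq_subLR -ltnS (leq_trans nk)//.
  by rewrite -addn1 sqrnD exp1n muln1 mulSn addnC addnA; lia.
have head : `|\sum_(i < k.+1 ^ 2) v i| <= (k.+1 ^ 2)%:R * (e / 2).
  have /ltW/le_trans -> // := HK1 k (leq_trans (leq_maxl _ _) Kk).
  by rewrite ler_wpM2l// ltW.
have kK2 : 6 * M <= k.+1%:R * e.
  rewrite -ler_pdivrMr// (le_trans (ltW HK2))// ler_nat.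
  by rewrite ltnW// ltnS (leq_trans _ Kk)// leq_maxr.
have n_ge : (k.+1 ^ 2)%:R * e <= e * n.+1%:R.
  by rewrite mulrC ler_pM2l// ler_nat.
apply: le_trans n_ge; rewrite (le_trans (lerD head tail))//.
have : k.+1%:R * (6 * M) <= k.+1%:R * (k.+1%:R * e) by rewrite ler_wpM2l.
rewrite natrX expr2; move: (k.+1%:R : R) => x; lra.
Qed.

(** * The strong law of large numbers *)

Section slln.
Context {d} {Omega : measurableType d} {d'} {T : measurableType d'}
  {R : realType} {P : probability Omega R} {mu : probability T R}
  {Y : nat -> {RV P >-> T}} (iidY : iid mu Y).

(** Along the squares the Chebyshev bounds are summable, so Borel-Cantelli controls the centred sums
    there for every threshold indexed by [q]; boundedness of [f] fills the gaps. *)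
Lemma slln_bounded (f : T -> R) (M : R) :
  measurable_fun [set: T] f -> (forall x, `|f x| <= M) ->
  {ae P, forall w, sample_mean (fun i => Y i w) n f @[n --> \oo] -->
    \int[mu]_x f x}.
Proof.
move=> mf fM; set c := \int[mu]_x f x.
pose S n w := \sum_(i < n) (f (Y i w) - c).
have mS n : measurable_fun [set: Omega] (S n).
  by apply: measurable_sum => i; apply: measurable_funB => //;
    exact: measurableT_comp.
have ae_small : {ae P, forall w, forall q, \forall k \near \oo,
    ~ ((k.+1 ^ 2)%:R / q.+1%:R <= `|S (k.+1 ^ 2)%N w|)}.
  apply/ae_foralln => q; set F2 := \int[mu]_x (f x) ^+ 2.
  have F20 : 0 <= F2 by apply: Rintegral_ge0 => x _; exact: sqr_ge0.
  apply: (@borel_cantelli_ae _ _ _ P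
    (fun k => [set w | (k.+1 ^ 2)%:R / q.+1%:R <= `|S (k.+1 ^ 2)%N w|])
    (q.+1%:R ^+ 2 * F2 * 2)) => [k|K].
    rewrite -[X in measurable X]setTI; apply: measurable_fun_le => //.
    exact: measurableT_comp.
  (* With [x ^+ 2] samples, [x = k.+1], and deviation [x ^+ 2 / y], [y = q.+1], the Chebyshev bound
     decays like the inverse square of [x]. *)
  have cancel (x y z : R) : x != 0 -> y != 0 ->
      ((x ^+ 2 / y) ^+ 2)^-1 * (x ^+ 2 * z) = y ^+ 2 * z * (x ^+ 2)^-1.
    by move=> x0 y0; field; rewrite x0 y0.
  pose b (k : nat) := q.+1%:R ^+ 2 * F2 * (k.+1%:R ^+ 2)^-1 : R.
  apply: (@le_trans _ _ (\sum_(k < K) (b k)%:E)%E).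
    apply: lee_sum => k _.
    apply: (le_trans (iid_chebyshev iidY _ mf fM _)).
      by rewrite divr_gt0// ltr0n// expn_gt0.
    rewrite lee_fin /b natrX le_eqVlt; apply/orP; left; apply/eqP; rewrite -/F2.
    by apply: cancel; rewrite pnatr_eq0.
  rewrite sumEFin lee_fin -mulr_sumr ler_wpM2l//; last exact: sum_inv_squares_le2.
  by rewrite mulr_ge0// sqr_ge0.
apply: filterS ae_small => w small.
apply/cvgrPdist_le => e e0.
have := @mean_small_from_squares _ (fun i => f (Y i w) - c) (M + `|c|) _ _ e e0.
case; first by move=> i; rewrite (le_trans (ler_normB _ _))// lerD2r.
  move=> q; apply: filterS (small q) => k /negP; rewrite -ltNge; exact.
move=> N _ HN; exists N => // n Nn; have := HN n Nn.
rewrite /sample_mean distrC => H.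
rewrite (_ : _ - c = n.+1%:R^-1 * \sum_(i < n.+1) (f (Y i w) - c)).
  by rewrite normrM ger0_norm ?invr_ge0// mulrC ler_pdivrMr// ltr0n.
rewrite sumrB sumr_const card_ord mulrBr -[c *+ _]mulr_natl mulrA mulVf ?mul1r//.
Qed.

(* Truncating the first [2 ^ k] samples at level [2 ^ k], the probability that a
   truncation takes effect and the Chebyshev bound for the truncated sum are
   both dominated by integrals whose sums over [k] are at most a multiple of
   the integral of [h]. *)
Lemma sample_sum_eventually_le (h : T -> R) (e : R) :
  measurable_fun [set: T] h -> (forall x, 0 <= h x) ->
  mu.-integrable [set: T] (EFin \o h) -> 0 < e ->
  {ae P, forall w, \forall n \near \oo,
    sample_mean (fun i => Y i w) n h <= 2 * (\int[mu]_x h x + e)}.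
Proof.
move=> mh h0 ih e0; set m := \int[mu]_x h x.
have m0 : 0 <= m by exact: Rintegral_ge0.
pose S n w := \sum_(i < n) h (Y i w).
have mS n : measurable_fun [set: Omega] (S n).
  by apply: measurable_sum => i; exact: measurableT_comp.
pose F k := [set w | 2 ^+ k * (m + e) <= S (2 ^ k)%N w].
pose t (k : nat) x := if 2 ^+ k < h x then 1 else 0 : R.
have mt k : measurable_fun [set: T] (t k).
  by apply: measurable_fun_ifT => //; exact: measurable_fun_ltr.
have t01 k x : 0 <= t k x <= 1 by rewrite /t; case: ifP; rewrite ?lexx ?ler01.
have tM k x : `|t k x| <= 1.
  by have /andP[t0 t1] := t01 k x; rewrite ger0_norm.
have it k := bounded_integrable mu (mt k) (tM k).
pose u (k : nat) := truncate (2 ^+ k) h.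
have mu_ k : measurable_fun [set: T] (u k) by exact: measurable_truncate.
have p0 k : 0 < 2 ^+ k :> R by exact: exprn_gt0.
have uM k x : `|u k x| <= 2 ^+ k by apply: normr_truncate; exact: ltW.
have iu k := bounded_integrable mu (mu_ k) (uM k).
have iu2 k : mu.-integrable [set: T] (EFin \o (fun x => u k x ^+ 2)).
  apply: (bounded_integrable mu (M := (2 ^+ k) ^+ 2)).
    exact: measurable_funX.
  by move=> x; rewrite normrX ler_pXn2r// nnegrE// (le_trans _ (uM k x)).
(* The first summand gives the union bound for one of [2 ^ k] samples to exceed [2 ^+ k]; the second
   gives the Chebyshev bound for the truncated sum at deviation [2 ^+ k * e]. *)
pose G k x := 2 ^+ k * t k x + (e ^+ 2)^-1 * ((2 ^+ k)^-1 * u k x ^+ 2).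
have iZ c (g : T -> R) : mu.-integrable [set: T] (EFin \o g) ->
    mu.-integrable [set: T] (EFin \o (fun x => c * g x)).
  by move=> ig; apply: (integrableZl measurableT c ig).
have iG k : mu.-integrable [set: T] (EFin \o G k).
  exact: (integrableD measurableT (iZ _ _ (it k)) (iZ _ _ (iZ _ _ (iu2 k)))).
have PF k : (P (F k) <= (\int[mu]_x G k x)%:E)%E.
  pose E1 := [set w | 1 <= \sum_(i < 2 ^ k) t k (Y i w)].
  pose E2 := [set w | 2 ^+ k * e <=
    `|\sum_(i < 2 ^ k) (u k (Y i w) - \int[mu]_x u k x)|].
  have mt1 : measurable_fun [set: Omega] (fun w => \sum_(i < 2 ^ k) t k (Y i w)).
    by apply: measurable_sum => i; exact: measurableT_comp.
  have mE1 : measurable E1.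
    by rewrite -[E1]setTI; apply: measurable_fun_le.
  have mE2 : measurable E2.
    rewrite -[E2]setTI; apply: measurable_fun_le => //.
    apply: measurableT_comp => //; apply: measurable_sum => i.
    by apply: measurable_funB => //; exact: measurableT_comp.
  (* If no sample is truncated, the truncated sum equals [S] and is at least [2 ^+ k * (m + e)],
     while its expectation is at most [2 ^+ k * m] because [u k <= h]. *)
  have FE : F k `<=` E1 `|` E2.
    move=> w Fw; have [[i hi]|small] :=
        pselect (exists i : 'I_(2 ^ k), 2 ^+ k < h (Y i w)).
      left; rewrite /E1/= (bigD1 i)//= {1}/t hi lerDl sumr_ge0// => j _.
      by have /andP[] := t01 k (Y j w).
    right; rewrite /E2/=; apply: le_trans (ler_norm _).
    rewrite sumrB sumr_const card_ord -[_ *+ (2 ^ k)]mulr_natl natrX.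
    have -> : \sum_(i < 2 ^ k) u k (Y i w) = S (2 ^ k)%N w.
      apply: eq_bigr => i _; rewrite /u /truncate ger0_norm//.
      by case: ifPn => //; rewrite -ltNge => H; case: small; exists i.
    rewrite lerBrDl (le_trans _ Fw)// -mulrDr ler_pM2l// lerD2r.
    apply: le_Rintegral => // x _; rewrite /u /truncate.
    by case: ifP.
  rewrite (le_trans (le_measure P _ _ FE)) ?inE//.
  - rewrite -[F k]setTI; apply: measurable_fun_le => //.
  - exact: measurableU.
  rewrite (le_trans (measureU2 P mE1 mE2))//.
  have -> : \int[mu]_x G k x = 2 ^+ k * \int[mu]_x t k x +
      (e ^+ 2)^-1 * ((2 ^+ k)^-1 * \int[mu]_x (u k x ^+ 2)).
    rewrite RintegralD//; [|exact: iZ|exact: (iZ _ _ (iZ _ _ (iu2 k)))].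
    by rewrite RintegralZl// RintegralZl ?RintegralZl//; exact: iZ.
  rewrite EFinD leeD//.
    apply: (le_trans (markov_Rintegral _ _ _ _)) => //.
    - by move=> w; apply: sumr_ge0 => i _; have /andP[] := t01 k (Y i w).
    - apply: integrable_sum_EFin => i.
      apply: (bounded_integrable P (M := 1)) => //.
      exact: measurableT_comp.
    rewrite lee_fin invr1 mul1r Rintegral_sum => [|i].
      rewrite (eq_bigr (fun=> \int[mu]_x t k x)) => [|i _].
        by rewrite sumr_const card_ord -[_ *+ (2 ^ k)]mulr_natl natrX.
      exact: (iid_Rintegral iidY).
    apply: (bounded_integrable P (M := 1)) => //.
    exact: measurableT_comp.
  apply: (le_trans (iid_chebyshev iidY _ (mu_ k) (uM k) _)).
    exact: mulr_gt0.
  rewrite lee_fin natrX.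
  have cancel (x y z : R) : x != 0 -> y != 0 ->
      ((x * y) ^+ 2)^-1 * (x * z) = (y ^+ 2)^-1 * (x^-1 * z).
    by move=> x0 y0; field; rewrite x0 y0.
  by rewrite cancel ?gt_eqF.
(* Summing over [k] before integrating: at each point the two dyadic sums are bounded by multiples
   of [h x], uniformly in [K]. *)
have sumG K x : \sum_(k < K) G k x <= (2 + (e ^+ 2)^-1 * 2) * h x.
  rewrite big_split/= mulrDl lerD//.
    rewrite (le_trans _ (sum_dyadic_below K (h0 x)))// ler_sum// => k _.
    by rewrite /t; case: ifP; rewrite ?mulr1 ?mulr0.
  rewrite -mulr_sumr -mulrA ler_wpM2l ?invr_ge0 ?sqr_ge0//.
  rewrite (le_trans _ (sum_dyadic_above K (h0 x)))// ler_sum// => k _.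
  by rewrite /u /truncate ger0_norm.
have : {ae P, forall w, \forall k \near \oo, ~ F k w}.
  apply: (@borel_cantelli_ae _ _ _ P F ((2 + (e ^+ 2)^-1 * 2) * m)) => [k|K].
    by rewrite -[F k]setTI; apply: measurable_fun_le.
  apply: (@le_trans _ _ (\sum_(k < K) (\int[mu]_x G k x)%:E)%E).
    by apply: lee_sum => k _; exact: PF.
  rewrite sumEFin lee_fin -Rintegral_sum// -RintegralZl//.
  by apply: le_Rintegral => //; [exact: integrable_sum_EFin|exact: iZ].
apply: filterS => w [K _ HK]; exists (2 ^ K)%N => // n /= Kn.
(* Since [h] is nonnegative, the sum of [n.+1] terms is at most the one of [2 ^ k.+1] terms, and
   [2 ^ k.+1 <= 2 * n.+1] accounts for the factor 2 in the claim. *)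
have /andP[n1 n2] := trunc_log_bounds (isT : (1 < 2)%N) (ltn0Sn n).
set k := trunc_log 2 n.+1 in n1 n2.
have Kk : (K <= k.+1)%N.
  by rewrite ltnW// -(@ltn_exp2l 2)// (leq_ltn_trans Kn)// (ltn_trans _ n2).
have := HK _ Kk; rewrite /F/= => /negP; rewrite -ltNge => /ltW SK.
rewrite /sample_mean ler_pdivrMl ?ltr0n// mulrCA.
have me : 0 <= m + e by rewrite addr_ge0// ltW.
apply: (@le_trans _ _ (S (2 ^ k.+1)%N w)).
  rewrite /S -!(big_mkord xpredT (fun i => h (Y i w))).
  rewrite [leRHS](@big_cat_nat _ _ _ n.+1)//=; last exact: ltnW.
  by rewrite lerDl; apply: sumr_ge0.
rewrite (le_trans SK)// mulrA ler_wpM2r// exprS ler_wpM2l//.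
by rewrite -natrX ler_nat.
Qed.

End slln.

Section sample_mean_lemmas.
Context {T : Type} {R : realType} (y : nat -> T) (n : nat).
Implicit Types f g : T -> R.

Lemma sample_meanD f g :
  sample_mean y n (fun x => f x + g x) = sample_mean y n f + sample_mean y n g.
Proof. by rewrite /sample_mean big_split/= mulrDr. Qed.

Lemma sample_meanB f g :
  sample_mean y n (fun x => f x - g x) = sample_mean y n f - sample_mean y n g.
Proof. by rewrite /sample_mean sumrB mulrBr. Qed.

Lemma sample_meanZ c g :
  sample_mean y n (fun x => c * g x) = c * sample_mean y n g.
Proof. by rewrite /sample_mean -mulr_sumr mulrCA. Qed.

Lemma sample_mean_cst c : sample_mean y n (fun=> c) = c :> R.
Proof.
by rewrite /sample_mean sumr_const card_ord -[c *+ _]mulr_natl mulrA mulVf ?mul1r.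
Qed.

Lemma le_sample_mean f g :
  (forall x, f x <= g x) -> sample_mean y n f <= sample_mean y n g.
Proof. by move=> fg; rewrite ler_wpM2l ?invr_ge0// ler_sum. Qed.

Lemma normr_sample_mean g :
  `|sample_mean y n g| <= sample_mean y n (fun x => `|g x|).
Proof.
by rewrite /sample_mean normrM ger0_norm ?invr_ge0// ler_wpM2l ?invr_ge0// ler_norm_sum.
Qed.

End sample_mean_lemmas.

(** Dominated convergence under [|g|]: at each point the remainder is zero once [q] exceeds
    [|g x|]. *)
Lemma cvg_Rintegral_truncate {d} {T : measurableType d} {R : realType}
    (mu : {measure set T -> \bar R}) (g : T -> R) :
  measurable_fun [set: T] g -> mu.-integrable [set: T] (EFin \o g) ->
  \int[mu]_x `|g x - truncate q%:R g x| @[q --> \oo] --> (0 : R).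
Proof.
move=> mg ig.
have mr q : measurable_fun [set: T] (fun x => `|g x - truncate q%:R g x|).
  apply: measurableT_comp => //; apply: measurable_funB => //.
  exact: measurable_truncate.
have rg q x : `|g x - truncate q%:R g x| <= `|g x|.
  by rewrite /truncate; case: ifP => _; rewrite ?subr0// subrr normr0.
have ing := integrable_norm ig.
have [|//||_ _] := @dominated_convergence _ _ _ mu _ measurableT
  (fun q x => (`|g x - truncate q%:R g x|)%:E) (cst 0%E) (fun x => (`|g x|)%:E)
  (fun q => (measurable_EFinP _ _).2 (mr q)) (measurable_cst _).
- apply: aeW => x _ /=; apply: cvg_near_cst.
  exists (Num.bound `|g x|) => // q /= gq; rewrite /truncate ifT ?subrr ?normr0//.
  by rewrite ltW// (lt_le_trans (archi_boundP _))// ler_nat.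
- by apply: aeW => x q _ /=; rewrite lee_fin normr_id.
by rewrite integral0 => /fine_cvgP[].
Qed.

(** The bounded part and the tail are controlled almost surely for all levels [q] simultaneously, so
    [q] may be chosen after [w] and [e], with the integral of the tail small. *)
Theorem strong_law_of_large_numbers {d} {Omega : measurableType d} {d'}
    {T : measurableType d'} {R : realType} {P : probability Omega R}
    {mu : probability T R} {Y : nat -> {RV P >-> T}} (iidY : iid mu Y)
    (g : T -> R) :
  measurable_fun [set: T] g -> mu.-integrable [set: T] (EFin \o g) ->
  {ae P, forall w, sample_mean (fun i => Y i w) n g @[n --> \oo] -->
    \int[mu]_x g x}.
Proof.
move=> mg ig.
pose u (q : nat) := truncate q%:R g; pose r q x : R := `|g x - u q x|.
have mu_ q : measurable_fun [set: T] (u q) by exact: measurable_truncate.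
have mr q : measurable_fun [set: T] (r q).
  by apply: measurableT_comp => //; exact: measurable_funB.
have uM q x : `|u q x| <= q%:R by exact: normr_truncate.
have iu q := bounded_integrable mu (mu_ q) (uM q).
have iB q : mu.-integrable [set: T] (EFin \o (fun x => g x - u q x)).
  exact: (integrableB measurableT ig (iu q)).
have ir q : mu.-integrable [set: T] (EFin \o r q).
  exact: integrable_norm (iB q).
have aeu : {ae P, forall w, forall q,
    sample_mean (fun i => Y i w) n (u q) @[n --> \oo] --> \int[mu]_x u q x}.
  by apply/ae_foralln => q; exact: (slln_bounded iidY (mu_ q) (uM q)).
have aer : {ae P, forall w, forall q, \forall n \near \oo,
    sample_mean (fun i => Y i w) n (r q) <=
    2 * (\int[mu]_x r q x + q.+1%:R^-1)}.
  apply/ae_foralln => q; apply: (sample_sum_eventually_le iidY (mr q)) => //.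
    by move=> x; exact: normr_ge0.
(* [G], [U] stand for the integrals of [g] and [u q], and [G'], [U'] for their sample means. The
   three errors are at most [e / 8], [e / 8] and [2 * (e / 8 + e / 8)]. *)
have aux (G U G' U' rho r' k e : R) : `|G - U| <= rho -> `|U - U'| <= e / 8 ->
    `|G' - U'| <= r' -> r' <= 2 * (rho + k) -> rho <= e / 8 -> k <= e / 8 ->
    `|G - G'| <= e.
  move=> GU UU GU' rk rhoe ke.
  rewrite (_ : G - G' = (G - U) + ((U - U') - (G' - U'))); last by ring.
  rewrite (le_trans (ler_normD _ _))//.
  have := ler_normB (U - U') (G' - U'); have := normr_ge0 (G - U); lra.
apply: filterS2 aeu aer => w cu cr; apply/cvgrPdist_le => e e0.
have e8 : 0 < e / 8 by rewrite divr_gt0.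
have [q [q1 q2]] : exists q, \int[mu]_x r q x <= e / 8 /\ q.+1%:R^-1 < e / 8.
  have [N1 _ H1] : \forall q \near \oo, `|\int[mu]_x r q x| <= e / 8.
    have /cvgrPdist_le/(_ _ e8) := cvg_Rintegral_truncate mg ig.
    by apply: filterS => q; rewrite sub0r normrN.
  have [N2 _ H2] := near_infty_natSinv_lt (PosNum e8).
  exists (maxn N1 N2); split.
    by rewrite (le_trans (ler_norm _))// H1//= leq_maxl.
  by apply: H2; rewrite /= leq_maxr.
have /cvgrPdist_le/(_ _ e8) cq := cu q.
near=> n.
have n1 : `|\int[mu]_x u q x - sample_mean (fun i => Y i w) n (u q)| <= e / 8.
  by near: n.
have n2 : sample_mean (fun i => Y i w) n (r q) <=
    2 * (\int[mu]_x r q x + q.+1%:R^-1).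
  by near: n; exact: cr.
have n3 : `|sample_mean (fun i => Y i w) n g - sample_mean (fun i => Y i w) n (u q)|
    <= sample_mean (fun i => Y i w) n (r q).
  by rewrite -sample_meanB; exact: normr_sample_mean.
have n4 : `|\int[mu]_x g x - \int[mu]_x u q x| <= \int[mu]_x r q x.
  by rewrite -RintegralB//; exact: le_normr_Rintegral.
by rewrite (aux _ _ _ _ _ _ _ _ n4 n1 n3 n2 q1 (ltW q2)).
Unshelve. all: by end_near. Qed.

(** * Inequalities for powers, and powers of the distance *)

Lemma powR_sub_le {R : realType} (p a b : R) : 1 <= p -> 0 <= a -> 0 <= b ->
  `|a `^ p - b `^ p| <= p * `|a - b| * (a `^ (p - 1) + b `^ (p - 1)).
Proof.
move=> p1; wlog ab : a b / b <= a => [wh a0 b0|a0 b0].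
  have [ab|/ltW ab] := leP b a; first exact: wh.
  by rewrite distrC (distrC a) [a `^ _ + _]addrC; exact: wh.
have p0 : 0 < p by lra.
have ap : b `^ p <= a `^ p by rewrite ge0_ler_powR ?nnegrE// ltW.
rewrite !ger0_norm ?subr_ge0//.
(* For [b <= a] this is the tangent bound expressing convexity of the power; the second power in the
   claim makes it symmetric. *)
apply: (@le_trans _ _ (p * (a - b) * a `^ (p - 1))); last first.
  by rewrite ler_wpM2l ?lerDl ?powR_ge0// mulr_ge0 ?subr_ge0// ltW.
have E := mulr_powRB1 a0 p0.
(* At [p = 1] the conjugate exponent is infinite; there the bound is an equality, as the power with
   exponent 0 is 1 even at [a = 0]. *)
move: p1; rewrite le_eqVlt => /predU1P[<-|p1].
  by rewrite !powRr1// subrr powRr0 mul1r mulr1.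
(* Young's inequality for [b * a `^ (p - 1)], with exponents [p] and [p / (p - 1)] *)
have q0 : 0 < p / (p - 1) by rewrite divr_gt0// subr_gt0.
have := conjugate_powR b0 (powR_ge0 a (p - 1)) p0 q0.
have -> : p^-1 + (p / (p - 1))^-1 = 1.
  by field; apply/andP; split; lra.
rewrite -powRrM (_ : (p - 1) * (p / (p - 1)) = p); last by field; lra.
move=> /(_ erefl) H.
have : p * (b * a `^ (p - 1)) <= b `^ p + (p - 1) * a `^ p.
  rewrite -(ler_pM2l p0) in H; apply: (le_trans H).
  rewrite le_eqVlt; apply/orP; left; apply/eqP; field.
  by apply/andP; split; lra.
by rewrite -E; lra.
Qed.

(** The sum is at most twice the larger term. This covers exponents below 1 as well, which occur as
    [p - 1]. *)
Lemma powRD_le {R : realType} (r a b : R) : 0 <= r -> 0 <= a -> 0 <= b ->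
  (a + b) `^ r <= 2 `^ r * (a `^ r + b `^ r).
Proof.
move=> r0; wlog ab : a b / b <= a => [wh a0 b0|a0 b0].
  have [ab|/ltW ab] := leP b a; first exact: wh.
  by rewrite addrC [a `^ _ + _]addrC; exact: wh.
apply: (@le_trans _ _ ((2 * a) `^ r)).
  by rewrite ge0_ler_powR ?nnegrE; lra.
by rewrite powRM// ler_wpM2l ?powR_ge0// lerDl powR_ge0.
Qed.

(** An injection of [D] into the naturals reduces this to countable intersections indexed by [nat];
    indices outside its image impose no condition. *)
Lemma ae_forall_countable {d} {T : measurableType d} {R : realType}
    (P : {measure set T -> \bar R}) (I : Type) (D : set I) (Q : I -> T -> Prop) :
  countable D -> (forall i, D i -> {ae P, forall w, Q i w}) ->
  {ae P, forall w, forall i, D i -> Q i w}.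
Proof.
move=> /countable_injP[f finj] DQ.
have : {ae P, forall w, forall n i, D i -> f i = n -> Q i w}.
  apply/ae_foralln => n.
  have [[i [Di fi]]|H] := pselect (exists i, D i /\ f i = n).
    apply: filterS (DQ i Di) => w Qi j Dj fj.
    by rewrite -(finj i j) ?inE// fi fj.
  by apply: aeW => w i Di fi; case: H; exists i.
by apply: filterS => w H i Di; exact: (H (f i)).
Qed.

Lemma open_mdist_lt {R : realType} {X : metricType R} (x : X) (r : R) :
  open [set y | mdist x y < r].
Proof.
rewrite openE => y /= xy; apply/nbhs_ballP.
exists (r - mdist x y) => /=; first by rewrite subr_gt0.
move=> z; rewrite ballEmdist/= => yz.
by rewrite (le_lt_trans (metric_triangle x y z))// addrC -ltrBrDr.
Qed.

Section power_distance.
Context {R : realType} {X : pmetricType R}.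

(** The preimages of the generating half-lines are open balls. *)
Lemma measurable_mdist (x : X) :
  measurable_fun [set: borel X] (fun y : borel X => mdist x (y : X)).
Proof.
apply: (measurability _ (RGenInftyO.measurableE R)) => //.
move=> /= _ [_ [r ->] <-]; rewrite setTI.
apply: sub_sigma_algebra.
rewrite (_ : _ @^-1` _ = [set y | mdist x y < r]); first exact: open_mdist_lt.
by apply/seteqP; split => y /=; rewrite in_itv.
Qed.

Lemma measurable_mdist_powR (x : X) (r : R) :
  measurable_fun [set: borel X] (fun y : borel X => mdist x (y : X) `^ r).
Proof.
exact: (measurableT_comp (measurable_powR r) (measurable_mdist x)).
Qed.

(** The triangle inequality moves the powers of order [p - 1] from [a] and [b] to the base point
    [o], so that one weight in [y] serves all points within [B] of [o]. *)
Lemma mdist_powR_lipschitz (p B : R) (o a b y : X) : 1 <= p ->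
  mdist o a <= B -> mdist o b <= B ->
  `|mdist a y `^ p - mdist b y `^ p| <=
  p * 2 `^ (p - 1) * 2 * mdist a b * (B `^ (p - 1) + mdist o y `^ (p - 1)).
Proof.
move=> p1 aB bB; have q0 : 0 <= p - 1 by lra.
have p0 : 0 <= p by lra.
have B0 : 0 <= B by rewrite (le_trans _ aB)// mdist_ge0.
have bound c : mdist o c <= B -> mdist c y `^ (p - 1) <=
    2 `^ (p - 1) * (B `^ (p - 1) + mdist o y `^ (p - 1)).
  move=> cB; rewrite (le_trans _ (powRD_le q0 B0 (mdist_ge0 o y)))//.
  apply: ge0_ler_powR => //; rewrite ?nnegrE ?mdist_ge0//.
    by rewrite addr_ge0 ?mdist_ge0.
  by rewrite (le_trans (metric_triangle c o y))// lerD2r metric_sym.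
rewrite (le_trans (powR_sub_le p1 (mdist_ge0 _ _) (mdist_ge0 _ _)))//.
have dab : `|mdist a y - mdist b y| <= mdist a b.
  rewrite ler_distl; apply/andP; split.
    by rewrite lerBlDr addrC (metric_sym a b); exact: metric_triangle.
  by rewrite addrC; exact: metric_triangle.
set S := B `^ (p - 1) + _.
apply: (@le_trans _ _ (p * mdist a b * (2 `^ (p - 1) * S + 2 `^ (p - 1) * S))).
  apply: ler_pM.
  - by rewrite mulr_ge0.
  - by rewrite addr_ge0 ?powR_ge0.
  - by rewrite ler_wpM2l.
  - by rewrite lerD// bound.
by rewrite le_eqVlt; apply/orP; left; apply/eqP; ring.
Qed.

(** The integrand of [frechet_fun]; it grows only like the power [p - 1] of the distance, hence the
    moment of that order makes it integrable. *)
Definition dist_gap (p : R) (a b : X) (y : borel X) : R :=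
  mdist a (y : X) `^ p - mdist b (y : X) `^ p.

Lemma measurable_dist_gap p a b : measurable_fun [set: borel X] (dist_gap p a b).
Proof. by apply: measurable_funB; exact: measurable_mdist_powR. Qed.

Lemma dist_gap_lipschitz (p B r : R) (o a b a' b' : X) (y : borel X) : 1 <= p ->
  mdist o a <= B -> mdist o a' <= B -> mdist o b <= B -> mdist o b' <= B ->
  mdist a a' <= r -> mdist b b' <= r ->
  `|dist_gap p a b y - dist_gap p a' b' y| <=
  p * 2 `^ (p - 1) * 4 * r * (B `^ (p - 1) + mdist o (y : X) `^ (p - 1)).
Proof.
move=> p1 aB a'B bB b'B aa' bb'.
have := mdist_powR_lipschitz (y : X) p1 aB a'B.
have := mdist_powR_lipschitz (y : X) p1 bB b'B.
rewrite /dist_gap; set K := p * _; set S := B `^ _ + _.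
have K0 : 0 <= K by rewrite mulr_ge0 ?powR_ge0; lra.
have S0 : 0 <= S by rewrite addr_ge0 ?powR_ge0.
have le_r (c c' : X) : mdist c c' <= r -> K * 2 * mdist c c' * S <= K * 2 * r * S.
  by move=> cc'; rewrite ler_wpM2r// ler_wpM2l// mulr_ge0.
have := le_r _ _ aa'; have := le_r _ _ bb'.
move: (mdist a y `^ p) (mdist a' y `^ p) (mdist b y `^ p) (mdist b' y `^ p).
move=> A A' B1 B1' h1 h2 h3 h4.
rewrite (_ : _ - _ - _ = (A - A') - (B1 - B1')); last by ring.
rewrite (le_trans (ler_normB _ _))//.
rewrite (_ : K * 4 * r * S = K * 2 * r * S + K * 2 * r * S); last by ring.
exact: lerD (le_trans h4 h2) (le_trans h3 h1).
Qed.

End power_distance.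

(** * Empirical integrals and integrability of the integrands *)

Lemma integral_empirical {d} {T : measurableType d} {R : realType}
    (y : nat -> T) (n : nat) (g : T -> R) : measurable_fun [set: T] g ->
  (\int[empirical R y n]_x (g x)%:E = (sample_mean y n g)%:E)%E.
Proof.
move=> mg.
(* Nonnegative functions integrate additively over the sum of Dirac measures; a signed [g] is then
   split into its positive and negative parts. *)
have pos (h : T -> \bar R) : measurable_fun [set: T] h -> (forall x, 0 <= h x)%E ->
    (\int[empirical R y n]_x h x =
     (n.+1%:R^-1)%:E * \sum_(i < n.+1) h (y i))%E.
  move=> mh h0; rewrite /empirical ge0_integral_mscale//.
  rewrite ge0_integral_measure_sum//; congr (_ * _)%E.
  apply: eq_bigr => i _; rewrite integral_dirac//.
  by rewrite diracT mul1e.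
have mg' : measurable_fun [set: T] (EFin \o g) by exact/measurable_EFinP.
rewrite integralE pos//; last exact: measurable_funepos.
rewrite pos//; last exact: measurable_funeneg.
rewrite (eq_bigr (fun i : 'I_n.+1 => (Num.max (g (y i)) 0)%:E)); last first.
  by move=> i _; rewrite funeposE/= EFin_max.
rewrite [X in (_ - _ * X)%E](eq_bigr
  (fun i : 'I_n.+1 => (Num.max (- g (y i)) 0)%:E)); last first.
  by move=> i _; rewrite funenegE/= EFin_max.
rewrite !sumEFin -!EFinM -EFinB -mulrBr -sumrB; congr (_ * _)%:E.
apply: eq_bigr => i _; case: (leP (g (y i)) 0) => gi.
  by rewrite max_l ?oppr_ge0// sub0r opprK.
by rewrite max_r ?oppr_le0 ?subr0// ltW.
Qed.

Lemma integrable_mdist_powR {R : realType} {X : pmetricType R}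
    (mu : probability (borel X) R) (r : R) (o : X) : finite_moment r mu ->
  mu.-integrable [set: borel X] (EFin \o (fun t : borel X => mdist o (t : X) `^ r)).
Proof.
move=> mom; apply/integrableP; split.
  by apply/measurable_EFinP; exact: measurable_mdist_powR.
apply: le_lt_trans (mom o); rewrite le_eqVlt; apply/orP; left; apply/eqP.
by apply: eq_integral => t _ /=; rewrite ger0_norm ?powR_ge0.
Qed.

(** The bound of [mdist_powR_lipschitz] with base point [a] and radius [mdist a b] is an integrable
    majorant. *)
Lemma integrable_dist_gap {R : realType} {X : pmetricType R}
    (mu : probability (borel X) R) (p : R) (a b : X) :
  1 <= p -> finite_moment (p - 1) mu ->
  mu.-integrable [set: borel X] (EFin \o dist_gap p a b).
Proof.
move=> p1 mom; have iW := integrable_mdist_powR a mom.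
pose g (t : borel X) := p * 2 `^ (p - 1) * 2 * mdist a b *
  (mdist a b `^ (p - 1) + mdist a (t : X) `^ (p - 1)) : R.
apply: (@integrable_normr_le _ _ _ _ _ g).
- exact: measurable_dist_gap.
- by move=> t; apply: mdist_powR_lipschitz => //; rewrite mdistxx mdist_ge0.
- apply: (integrableZl measurableT _
    (f := EFin \o (fun t : borel X => mdist a b `^ (p - 1) + mdist a (t : X) `^ (p - 1)))) => //.
  apply: (integrableD measurableT _ iW (f := EFin \o cst (mdist a b `^ (p - 1)))).
  exact: finite_measure_integrable_cst.
Qed.

(** * The deterministic passage to the limit *)

Lemma frechet_mean_limit {R : realType} {X : pmetricType R}
    (mu : probability (borel X) R) (p : R) (y : nat -> borel X) (o : X)
    (D : set X) (C_ : nat -> set X) (C : set X) (eta_ : nat -> R) (eta : R) :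
  1 <= p -> dense D -> finite_moment (p - 1) mu ->
  (forall a b, D a -> D b ->
    sample_mean y n (dist_gap p a b) @[n --> \oo] -->
    \int[mu]_t dist_gap p a b t) ->
  sample_mean y n (fun t => mdist o (t : X) `^ (p - 1)) @[n --> \oo] -->
    \int[mu]_t (mdist o (t : X) `^ (p - 1)) ->
  Lt C_ C -> eta_ n @[n --> \oo] --> eta ->
  Ls (fun n => frechet_mean p (empirical R y n) (C_ n) (eta_ n)) `<=`
  frechet_mean p mu C eta.
Proof.
move=> p1 denseD mom cvg_gap cvg_mom [LsC LiC] cvg_eta x xLs.
pose W (t : borel X) := mdist o (t : X) `^ (p - 1).
have mW : measurable_fun [set: borel X] W by exact: measurable_mdist_powR.
have W0 t : 0 <= W t by exact: powR_ge0.
have iW := integrable_mdist_powR o mom.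
split.
  (* Membership in [C]: the means lie in the sets [C_ n], and [Ls] is monotone. *)
  rewrite -LsC => N _; apply: closureS (xLs N I) => // z [n Nn [Cz _]].
  by exists n.
move=> z Cz.
pose q := p - 1; pose K : R := p * 2 `^ q * 4.
have K0 : 0 <= K by rewrite mulr_ge0// mulr_ge0 ?powR_ge0//; lra.
(* The margin 1 keeps every point within [r <= 1] of [x] or [z] in the ball of radius [B] about
   [o]. *)
pose B := Num.max (mdist o x) (mdist o z) + 1.
have xB : mdist o x + 1 <= B by rewrite lerD2r le_max lexx.
have zB : mdist o z + 1 <= B by rewrite lerD2r le_max lexx orbT.
have nearB (c c' : X) r : r <= 1 -> mdist o c + 1 <= B -> mdist c c' < r -> mdist o c' <= B.
  move=> r1 cB cc'; rewrite (le_trans (metric_triangle o c c'))//.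
  by rewrite (le_trans _ cB)// lerD2l ltW// (lt_le_trans cc').
have lip r (a b a' b' : X) t :
    mdist o a <= B -> mdist o a' <= B -> mdist o b <= B -> mdist o b' <= B ->
    mdist a a' <= r -> mdist b b' <= r ->
    `|dist_gap p a b t - dist_gap p a' b' t| <= K * r * (B `^ q + W t).
  exact: dist_gap_lipschitz.
have iBW r : mu.-integrable [set: borel X]
    (EFin \o (fun t => K * r * (B `^ q + W t))).
  apply: (integrableZl measurableT (K * r) (f := EFin \o (fun t => B `^ q + W t))) => //.
  apply: (integrableD measurableT _ iW (f := EFin \o cst (B `^ q))).
  exact: finite_measure_integrable_cst.
have igap a b : mu.-integrable [set: borel X] (EFin \o dist_gap p a b).
  exact: integrable_dist_gap.
have [ox oz] : mdist o x <= B /\ mdist o z <= B by split; lra.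
have -> : frechet_fun p mu x z = (\int[mu]_t dist_gap p x z t)%:E.
  by rewrite /Rintegral fineK//; apply: integrable_fin_num => //; exact: igap.
rewrite lee_fin; set m := \int[mu]_t W t.
have m0 : 0 <= m by exact: Rintegral_ge0.
(* [r * A] is the total error: [x], [z] replaced by dense points under [mu], these replaced by [xn],
   [zn] (at distance below [2 * r]) under the sample, where the mean of [W] is at most [m + 1], and
   one [r] each for the law of large numbers and for [eta_]. *)
pose A := K * (B `^ q + m) + 2 * K * (B `^ q + (m + 1)) + 2.
have A0 : 0 < A.
  have Bq : 0 <= B `^ q by exact: powR_ge0.
  have K1 : 0 <= K * (B `^ q + m) by apply: mulr_ge0 => //; lra.
  have K2 : 0 <= K * (B `^ q + (m + 1)) by apply: mulr_ge0 => //; lra.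
  by rewrite ltr_wpDl// addr_ge0// -mulrA mulr_ge0.
apply/ler_addgt0Pr => e e0.
pose r := Num.min 1 (e / A).
have r0 : 0 < r by rewrite lt_min ltr01 divr_gt0.
have r1 : r <= 1 by rewrite ge_min lexx.
have rA : r * A <= e by rewrite -ler_pdivlMr// ge_min lexx orbT.
have ball0 (c : X) : [set t | mdist c t < r] c by rewrite /= mdistxx.
have [x' [/= xx' Dx']] := denseD _ (ex_intro _ x (ball0 x)) (open_mdist_lt x r).
have [z' [/= zz' Dz']] := denseD _ (ex_intro _ z (ball0 z)) (open_mdist_lt z r).
have ox' := nearB _ _ _ r1 xB xx'; have oz' := nearB _ _ _ r1 zB zz'.
have [N1 _ H1] : \forall n \near \oo,
    `|\int[mu]_t dist_gap p x' z' t - sample_mean y n (dist_gap p x' z')| <= r.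
  by have /cvgrPdist_le := cvg_gap _ _ Dx' Dz'; exact.
have [N2 _ H2] : \forall n \near \oo, `|m - sample_mean y n W| <= r.
  by have /cvgrPdist_le := cvg_mom; exact.
have [N3 _ H3] : \forall n \near \oo, `|eta - eta_ n| <= r.
  by have /cvgrPdist_le := cvg_eta; exact.
have [N4 _ H4] : \forall n \near \oo, C_ n `&` [set t | mdist z t < r] !=set0.
  by move: Cz; rewrite -LiC; apply; split; [exact: open_mdist_lt|exact: ball0].
pose N := maxn (maxn N1 N2) (maxn N3 N4).
have nbhs_x : nbhs x [set t | mdist x t < r].
  by apply: open_nbhs_nbhs; split; [exact: open_mdist_lt|exact: ball0].
(* [Ls] gives a mean near [x] only for some index [n] beyond [N], whereas [Li] gives points of
   [C_ n] near [z] for all large [n]; hence both exist at a common [n]. *)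
have [xn [[n /= Nn [Cxn Hxn]] /= xxn]] := xLs N I _ nbhs_x.
have [zn [Czn /= zzn]] : C_ n `&` [set t | mdist z t < r] !=set0.
  by apply: H4; rewrite /= (leq_trans _ Nn)// /N !leq_max leqnn !orbT.
have oxn := nearB _ _ _ r1 xB xxn; have ozn := nearB _ _ _ r1 zB zzn.
have {}H1 := H1 n; have {}H2 := H2 n; have {}H3 := H3 n.
have : sample_mean y n (dist_gap p xn zn) <= eta_ n.
  have := Hxn _ Czn; rewrite /frechet_fun integral_empirical ?lee_fin//.
  exact: measurable_dist_gap.
have : \int[mu]_t dist_gap p x z t <=
    \int[mu]_t dist_gap p x' z' t + K * r * (B `^ q + m).
  rewrite -lerBlDl -RintegralB//.
  have -> : K * r * (B `^ q + m) = \int[mu]_t (K * r * (B `^ q + W t)).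
    rewrite RintegralZl//; last first.
      apply: (integrableD measurableT _ iW (f := EFin \o cst (B `^ q))).
      exact: finite_measure_integrable_cst.
    rewrite RintegralD//; last exact: finite_measure_integrable_cst.
    by rewrite Rintegral_cst//= probability_setT mulr1.
  apply: le_Rintegral => //.
    exact: (integrableB measurableT (igap _ _) (igap _ _)).
  move=> t _; rewrite (le_trans (ler_norm _))// lip//; exact: ltW.
have : sample_mean y n (dist_gap p x' z') <=
    sample_mean y n (dist_gap p xn zn) +
    K * (2 * r) * (B `^ q + sample_mean y n W).
  rewrite -lerBlDl -sample_meanB.
  rewrite -[B `^ q](sample_mean_cst y n) -sample_meanD -sample_meanZ.
  apply: le_sample_mean => t; rewrite (le_trans (ler_norm _))// lip//.
    rewrite (le_trans (metric_triangle x' x xn))// mulr_natl mulr2n.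
    by rewrite metric_sym lerD// ltW.
  rewrite (le_trans (metric_triangle z' z zn))// mulr_natl mulr2n.
  by rewrite metric_sym lerD// ltW.
have n1 : (N1 <= n)%N by rewrite (leq_trans _ Nn)// /N !leq_max leqnn.
have n2 : (N2 <= n)%N by rewrite (leq_trans _ Nn)// /N !leq_max leqnn !orbT.
have n3 : (N3 <= n)%N by rewrite (leq_trans _ Nn)// /N !leq_max leqnn !orbT.
move: (H1 n1) (H2 n2) (H3 n3) => {}H1 {}H2 {}H3.
have mW1 : sample_mean y n W <= m + 1.
  by move: H2; rewrite ler_distlC => /andP[_ /le_trans]; apply; rewrite lerD2l.
have Kr : K * (2 * r) * (B `^ q + sample_mean y n W) <=
    K * (2 * r) * (B `^ q + (m + 1)).
  by rewrite ler_wpM2l ?lerD2l// mulr_ge0// mulr_ge0// ltW.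
have rAE : r * A = K * r * (B `^ q + m) + K * (2 * r) * (B `^ q + (m + 1)) + r + r.
  by rewrite /A; ring.
have G1 : \int[mu]_t dist_gap p x' z' t <= sample_mean y n (dist_gap p x' z') + r.
  by move: H1; rewrite ler_distl => /andP[_].
have G3 : eta_ n <= eta + r.
  by move: H3; rewrite ler_distlC => /andP[_].
rewrite rAE in rA.
(* The chain runs from the integral at [x], [z] to the integral at [x'], [z'], to its sample mean,
   to the sample mean at [xn], [zn], to [eta_ n], to [eta]. *)
move=> h1 h2 h3.
apply: (le_trans h2); rewrite -lerBrDr; apply: (le_trans G1).
rewrite -lerBrDr; apply: (le_trans h1); rewrite -lerBrDr.
apply: (le_trans h3); apply: (le_trans G3).
move: rA Kr; set c1 := K * r * _; set c2 := K * (2 * r) * _; set c3 := K * (2 * r) * _.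
lra.
Qed.

Unset Implicit Arguments.

(* Sequences are indexed from 0: Y n, C_ n and eta_ n stand for Y_{n+1},
   C_{n+1} and eta_{n+1}, and empirical _ n is the measure of n+1 samples. *)
Theorem theorem4p3 (R : realType) (p : R) (X : pmetricType R)
    (mu : probability (borel X) R)
    (d : measure_display) (Omega : measurableType d) (P : probability Omega R)
    (Y : nat -> {RV P >-> borel X})
    (C_ : nat -> Omega -> closed_sets X) (eta_ : nat -> Omega -> R)
    (C : Omega -> closed_sets X) (eta : Omega -> R) :
  1 <= p ->
  separable X ->
  finite_moment (p - 1) mu ->
  measure_is_complete P ->
  iid mu Y ->
  (forall n, measurable_fun [set: Omega] (fun w => (C_ n w, eta_ n w))) ->
  (forall n w, 0 <= eta_ n w) ->
  measurable_fun [set: Omega] (fun w => (C w, eta w)) ->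
  (forall w, 0 <= eta w) ->
  {ae P, forall w,
    Lt (fun n => C_ n w) (C w) ->
    eta_ n w @[n --> \oo] --> eta w ->
    Ls (fun n =>
          frechet_mean p (empirical R (fun i => Y i w) n)
            (C_ n w) (eta_ n w))
    `<=` frechet_mean p mu (C w) (eta w)}.
Proof.
move=> p1 [D cD dD] mom _ iidY _ _ _ _.
(* There is one null set for each pair of points of the countable set [D], and below one more for
   the weight centred at [point]; outside their union the deterministic argument applies. *)
have gap_ae : {ae P, forall w a, D a -> forall b, D b ->
    sample_mean (fun i => Y i w) n (dist_gap p a b) @[n --> \oo] -->
    \int[mu]_t dist_gap p a b t}.
  apply: (ae_forall_countable cD) => a _; apply: (ae_forall_countable cD) => b _.
  apply: (strong_law_of_large_numbers iidY); first exact: measurable_dist_gap.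
  exact: integrable_dist_gap.
have mom_ae := strong_law_of_large_numbers iidY
  (measurable_mdist_powR (point : X) (p - 1)) (integrable_mdist_powR point mom).
apply: filterS2 gap_ae mom_ae => w gap_w mom_w LtC eta_w.
by apply: (frechet_mean_limit p1 dD mom _ mom_w LtC eta_w) => a b Da; exact: gap_w.
Qed.
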